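(* Let $L$ be a background language, $\mathfrak{B}$ an atomic base over $L$, and $\mathtt{GG}$ the system of Gentzen-grounding over the enriched Gentzen-language $\mathtt{Gen}^\varepsilon$ over $\mathfrak{B}$. Write $A\Leftrightarrow B$ for $(A\supset B)\times(B\supset A)$. For all formulas $\alpha,\beta$ (respectively $\alpha(x)$) of $L$, the following formulas are derivable in $\mathtt{GG}$ from no assumptions: (1) $\Pi\xi^{\alpha\wedge\beta}\big(\xi^{\alpha\wedge\beta}:\alpha\wedge\beta\ \Leftrightarrow\ \mathfrak{E}\xi^\alpha\,\mathfrak{E}\xi^\beta(\xi^{\alpha\wedge\beta}\equiv\wedge I(\xi^\alpha,\xi^\beta)\times(\xi^\alpha:\alpha\times\xi^\beta:\beta))\big)$; (2) $\Pi\xi^{\alpha\vee\beta}\big(\xi^{\alpha\vee\beta}:\alpha\vee\beta\ \Leftrightarrow\ \mathfrak{E}\xi^\alpha\,\mathfrak{E}\xi^\beta((\xi^{\alpha\vee\beta}\equiv\vee I(\xi^\alpha)\times\xi^\alpha:\alpha)+(\xi^{\alpha\vee\beta}\equiv\vee I(\xi^\beta)\times\xi^\beta:\beta))\big)$; (3) $\Pi\xi^{\alpha\to\beta}\big(\xi^{\alpha\to\beta}:\alpha\to\beta\ \Leftrightarrow\ \mathfrak{E}\mathtt{f}^\beta(\xi^{\alpha\to\beta}\equiv\;\to\! I\,\xi^\alpha(\mathtt{f}^\beta(\xi^\alpha))\times\Pi\xi^\alpha(\xi^\alpha:\alpha\supset\mathtt{f}^\beta(\xi^\alpha):\beta))\big)$;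 (4) $\Pi\xi^{\forall x\alpha(x)}\big(\xi^{\forall x\alpha(x)}:\forall x\,\alpha(x)\ \Leftrightarrow\ \mathfrak{E}\mathtt{h}^{\alpha(x)}_x(\xi^{\forall x\alpha(x)}\equiv\forall I\,x(\mathtt{h}^{\alpha(x)}_x(x))\times\Pi x(\mathtt{h}^{\alpha(x)}_x(x):\alpha(x)))\big)$; (5) $\Pi\xi^{\exists x\alpha(x)}\big(\xi^{\exists x\alpha(x)}:\exists x\,\alpha(x)\ \Leftrightarrow\ \mathfrak{E}x\,\mathfrak{E}\xi^{\alpha(x)}(\xi^{\exists x\alpha(x)}\equiv\exists I(\xi^{\alpha(x)})\times\xi^{\alpha(x)}:\alpha(x))\big)$.
   Context: **Background language and base.** $L$ is a first-order language with logical constants $\wedge,\vee,\to,\forall,\exists$ and an atomic constant $\bot$; $\mathrm{TERM}_L,\mathrm{ATOM}_L,\mathrm{FORM}_L$ are its sets of terms, atomic formulas and formulas. An atomic system over $L$ is a pair $\mathtt{S}=\langle L^*,\mathfrak{R}\rangle$ with $L^*\subseteq L$ and $\mathfrak{R}$ a recursively axiomatisable set of production rules from $\alpha_1,\dots,\alpha_n$ to $\beta$, where each $\alpha_i$ is an atomic formula of $L^*$ other than $\bot$, $\beta$ is an atomic formula of $L^*$ or $\bot$, and every variable free in $\beta$ is free in some $\alpha_i$. $\mathrm{DER}_{\mathtt{S}}$ is the set of its derivations. An atomic base $\mathfrak{B}$ over $L$ is a triple: the individual constants of $L$, the relational constants of $L$, and an atomic system $\mathtt{S}$ over $L$. **The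 language $\mathtt{Gen}$** has only typed terms (types are formulas of $L$). $\mathrm{TERM}_{\mathtt{Gen}}$ is the smallest set with the following closure conditions (writing $T:\alpha$ for ''$T$ is a term of type $\alpha$''; bound variables are written after the operational symbol): - a constant $\delta:\alpha$ for each derivation in $\mathrm{DER}_{\mathtt{S}}$ with no undischarged assumptions and no unbound variables, $\alpha$ being its conclusion; - typed-variables $\xi^\alpha_i:\alpha$ ($\alpha\in\mathrm{FORM}_L$, $i\in\mathbb{N}$; indices are often omitted); - if $T:\alpha$, $U:\beta$ then $\wedge I(T,U):\alpha\wedge\beta$; if $T:\alpha_1\wedge\alpha_2$ then $\wedge_{E,i}(T):\alpha_i$ ($i=1,2$); - if $T:\alpha_i$ then $\vee I[\alpha_i\rhd\alpha_1\vee\alpha_2](T):\alpha_1\vee\alpha_2$; if $T:\alpha\vee\beta$, $U:\gamma$, $Z:\gamma$ then $\vee E\,\xi^\alpha\,\xi^\beta(T,U,Z):\gamma$ (binding $\xi^\alpha$ in $U$ and $\xi^\beta$ in $Z$); - if $T:\beta$ then $\to\! I\,\xi^\alpha(T):\alpha\to\beta$ (binding $\xi^\alpha$); if $T:\alpha\to\beta$, $U:\alpha$ then $\to\! E(T,U):\beta$; - if $U:\alpha(x)$ then $\forall I\,x(U):\forall y\,\alpha(y)$ (binding $x$), provided $x\notin FV(\gamma)$ for every $\xi^\gamma\in FV^T(U)$; if $T:\forall x\,\alpha(x)$ then $\forall E[\forall x\alpha(x)\rhd\alpha(t)](T):\alpha(t)$, $t$ free for $x$ in $\alpha(x)$; -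 if $T:\alpha(t)$ then $\exists I[\alpha(t)\rhd\exists x\alpha(x)](T):\exists x\,\alpha(x)$, $t$ free for $x$ in $\alpha(x)$; if $T:\exists x\,\alpha(x)$, $U:\beta$ then $\exists E\,y\,\xi^{\alpha(y)}(T,U):\beta$ (binding $y$ and $\xi^{\alpha(y)}$ in $U$), provided $y\notin FV(\beta)$ and $y\notin FV(\gamma)$ for every $\xi^\gamma\in FV^T(U)$ with $\gamma\neq\alpha(y)$; - if $T:\bot$ then $\bot_\alpha(T):\alpha$. Operational types in square brackets are often omitted: $\vee I(\xi^\alpha)$, $\vee I(\xi^\beta)$ of type $\alpha\vee\beta$ stand for $\vee I[\alpha\rhd\alpha\vee\beta](\xi^\alpha)$, $\vee I[\beta\rhd\alpha\vee\beta](\xi^\beta)$, and $\exists I(\xi^{\alpha(x)})$ for $\exists I[\alpha(x)\rhd\exists x\alpha(x)](\xi^{\alpha(x)})$. $FV^I(T)$, $FV^T(T)$ are the sets of free individual variables and free typed-variables of $T$. Individual variables occur in a term via the types of its typed-variables and the operational types. Substitutions of individual terms for individual variables (also acting on types of typed-variables) and of terms $W:\alpha$ for $\xi^\alpha$ are capture-avoiding. $T(\xi^\alpha)$, $T(U)$, $T(x)$, $T(t)$ have the usual meaning with respect to such substitutions. **The enriched language $\mathtt{Gen}^\varepsilon$** adds functional variables $\mathtt{h}^\alpha_x$ and $\mathtt{f}^\alpha$ (countably many of each kind, for each $\alpha\in\mathrm{FORM}_L$), binary predicates $Gr$ and $\equiv$, and logical constants $\times$ (and), $+$ (or), $\supset$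 (implies), $\Pi$ (for all), $\mathfrak{E}$ (exists), $\bot^G$ (absurdity). New terms: $\mathtt{h}^\alpha_x(t):\alpha(t/x)$ for $t\in\mathrm{TERM}_L$ and $\mathtt{f}^\alpha(T):\alpha$ for $T\in\mathrm{TERM}_{\mathtt{Gen}}$; terms are closed under the operational symbols as before. Atomic formulas: $Gr(T,\alpha)$ for $T$ a term of type $\alpha$, written $T:\alpha$; $T\equiv U$ for $T,U$ terms of the same type; $\bot^G$. Formulas are built with $\times,+,\supset$ and with $\Pi\nu$, $\mathfrak{E}\nu$, $\nu$ any individual, typed- or functional variable. Substitution for functional variables: $\mathtt{h}^\beta_x(t)[U/\mathtt{h}^\beta_x]=U[t/x]$ for $U:\beta$ with $x\notin FV(\alpha)$ for all $\xi^\alpha\in FV^T(U)$, and $\mathtt{f}^\alpha(Z)[U/\mathtt{f}^\alpha]=U$ for $U:\alpha$; terms substituted for typed- and functional variables must belong to $\mathrm{TERM}_{\mathtt{Gen}}$. **The system $\mathtt{GG}$** is a natural deduction system; any formula of $\mathtt{Gen}^\varepsilon$ may be assumed. Its rules are as follows. *Type introductions.* Axiom $\delta:\alpha$ for each constant $\delta$ naming a derivation with conclusion $\alpha$. From $T:\alpha$ and $U:\beta$ infer $\wedge I(T,U):\alpha\wedge\beta$. From $T:\alpha_i$ infer $\vee I[\alpha_i\rhd\alpha_1\vee\alpha_2](T):\alpha_1\vee\alpha_2$. From a derivation of $T(\xi^\alpha):\beta$ from $\xi^\alpha:\alpha$ infer $\to\! I\,\xi^\alpha(T(\xi^\alpha)):\alpha\to\beta$,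 discharging $\xi^\alpha:\alpha$ ($\xi^\alpha$ not free in other undischarged assumptions). From $T(x):\alpha(x)$ infer $\forall I\,y(T(y/x)):\forall y\,\alpha(y/x)$ ($x$ not free in undischarged assumptions). From $T:\alpha(t/x)$ infer $\exists I[\alpha(t/x)\rhd\exists x\alpha(x)](T):\exists x\,\alpha(x)$. *Type eliminations* (in each case infer $A$ from the major premise and the derivation(s) of $A$ from the listed dischargeable assumptions): - $D_\wedge$: major $T:\alpha\wedge\beta$; discharge $T\equiv\wedge I(\xi^\alpha,\xi^\beta)$, $\xi^\alpha:\alpha$, $\xi^\beta:\beta$. - $D_\vee$: major $T:\alpha\vee\beta$; two minor derivations of $A$, one discharging $T\equiv\vee I(\xi^\alpha)$, $\xi^\alpha:\alpha$, the other $T\equiv\vee I(\xi^\beta)$, $\xi^\beta:\beta$. - $D_\to$: major $T:\alpha\to\beta$; discharge $T\equiv\;\to\! I\,\xi^\alpha(\mathtt{f}^\beta(\xi^\alpha))$, $\Pi\xi^\alpha(\xi^\alpha:\alpha\supset\mathtt{f}^\beta(\xi^\alpha):\beta)$. - $D_\forall$: major $T:\forall x\,\alpha(x)$; discharge $T\equiv\forall I\,x(\mathtt{h}^{\alpha(x)}_x(x))$, $\Pi x(\mathtt{h}^{\alpha(x)}_x(x):\alpha(x))$. - $D_\exists$: major $T:\exists x\,\alpha(x)$; discharge $T\equiv\exists I(\xi^{\alpha(x)})$, $\xi^{\alpha(x)}:\alpha(x)$. - $\bot$: from $T:\bot$ infer $\bot^G$. The proper variables ($\xi^\alpha,\xi^\beta$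 in $D_\wedge$, $D_\vee$; $\mathtt{f}^\beta$ in $D_\to$; $\mathtt{h}^{\alpha(x)}_x$ in $D_\forall$, also after replacing $x$ by any $t$; $x$ and $\xi^{\alpha(x)}$ in $D_\exists$) must not be free in $A$ or in undischarged assumptions on which the minor premise $A$ depends other than those discharged by the rule. *Equivalence rules.* Axiom $T\equiv T$; symmetry; transitivity; preservation of denotation ($\equiv_P$): from $T\equiv U$ and $U:\alpha$ infer $T:\alpha$. Congruence: for each operational symbol of $\mathtt{Gen}$ listed above ($\wedge I$, $\wedge_{E,i}$, $\vee I$, $\vee E$, $\to\! I$, $\to\! E$, $\forall I$, $\forall E$, $\exists I$, $\exists E$, with the same bound variables on both sides), from equivalence of corresponding arguments infer equivalence of the resulting terms. Injectivity for primitive symbols: from $\wedge I(T_1,T_2)\equiv\wedge I(U_1,U_2)$ infer $T_i\equiv U_i$; from $sI(T)\equiv sI(U)$ infer $T\equiv U$, for $sI$ one of $\vee I[\alpha_i\rhd\alpha_1\vee\alpha_2]$, $\to\! I\,\xi^\alpha$, $\forall I\,x$, $\exists I$. Equations (axioms): $\wedge_{E,i}(\wedge I(T_1,T_2))\equiv T_i$; $\vee E\,\xi^{\alpha_1}\xi^{\alpha_2}(\vee I[\alpha_i\rhd\alpha_1\vee\alpha_2](T),U_1(\xi^{\alpha_1}),U_2(\xi^{\alpha_2}))\equiv U_i(T)$; $\to\! E(\to\! I\,\xi^\alpha(T(\xi^\alpha)),U)\equiv T(U)$; $\forall E[\forall x\alpha(x)\rhd\alpha(t/x)](\forall I\,x(T(x)))\equiv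 T(t)$; $\exists E\,x\,\xi^{\alpha(x)}(\exists I[\alpha(t/x)\rhd\exists x\alpha(x)](T),U(x,\xi^{\alpha(x)}))\equiv U(t,T)$. *Logic.* Gentzen's introduction and elimination rules of first-order intuitionistic natural deduction for $\times,+,\supset,\Pi,\mathfrak{E}$, and from $\bot^G$ infer any $A$. Quantifier rules apply to individual, typed- and functional variables, with the usual proper-variable restrictions; the instantiating term $\tau$ in $\Pi$-elimination and $\mathfrak{E}$-introduction is a term of $L$ or of $\mathtt{Gen}$ (or the quantified variable itself), of type $\alpha$ if the variable is $\xi^\alpha$ or $\mathtt{f}^\alpha$, and, if the variable is $\mathtt{h}^\beta_x$, of type $\beta$ with $x\notin FV(\alpha)$ for all $\xi^\alpha\in FV^T(\tau)$. *)

(* Defs.v *)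
From HB Require Import structures.
From mathcomp Require Import all_boot.
From Stdlib Require List.

Set Implicit Arguments.
Unset Strict Implicit.
Unset Printing Implicit Defensive.

(** Syntax is locally nameless: free variables are named, bound ones are
    indices counting the enclosing binders, so that formulas and terms are
    identified up to renaming of bound variables and substitution cannot
    capture.  Raw expressions may contain dangling indices; [TERM], [FORM],
    [typ] and [wff] below only hold of expressions without any, because they
    are generated by the *named* binders ([allx x a], [AllI x T], [Pi nu A], ...),
    which abstract a named free variable. *)

(* Individual constants are the function symbols of arity 0.  The counting of
   the symbols only serves to express recursiveness. *)
Record language := Language {
  fsym : countType;
  rsym : countType;
  far : fsym -> nat;
  rar : rsym -> nat }.

Inductive tm (L : language) : Type :=
| Var (x : nat)
| Bnd (k : nat)
| App (f : fsym L) (ts : seq (tm L)).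
Arguments Var {L}.
Arguments Bnd {L}.

Inductive fml (L : language) : Type :=
| Bot
| Rel (r : rsym L) (ts : seq (tm L))
| And (a b : fml L)
| Or (a b : fml L)
| Imp (a b : fml L)
| All (a : fml L)
| Exi (a : fml L).
Arguments Bot {L}.

Section Coding.
Context (L : language).

Definition tm_ind_nested (P : tm L -> Prop)
    (HV : forall x, P (Var x)) (HB : forall k, P (Bnd k))
    (HA : forall f ts, List.Forall P ts -> P (App f ts)) : forall t, P t :=
  fix F t := match t with
  | Var x => HV x
  | Bnd k => HB k
  | App f ts => HA f ts ((fix G ts : List.Forall P ts :=
      match ts with
      | [::] => List.Forall_nil P
      | t :: ts => List.Forall_cons t (F t) (G ts)
      end) ts)
  end.

Fixpoint tm_enc (t : tm L) : GenTree.tree (nat + fsym L) :=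
  match t with
  | Var x => GenTree.Node 0 [:: GenTree.Leaf (inl x)]
  | Bnd k => GenTree.Node 1 [:: GenTree.Leaf (inl k)]
  | App f ts => GenTree.Node 2 (GenTree.Leaf (inr f) :: map tm_enc ts)
  end.

Fixpoint tm_dec (u : GenTree.tree (nat + fsym L)) : option (tm L) :=
  match u with
  | GenTree.Node 0 [:: GenTree.Leaf (inl x)] => Some (Var x)
  | GenTree.Node 1 [:: GenTree.Leaf (inl k)] => Some (Bnd k)
  | GenTree.Node 2 (GenTree.Leaf (inr f) :: us) => Some (App f (pmap tm_dec us))
  | _ => None
  end.

Lemma tm_encK : pcancel tm_enc tm_dec.
Proof.
elim/tm_ind_nested => //= f ts Hts; congr (Some (App f _)).
by elim: Hts => //= t {}ts -> _ ->.
Qed.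

HB.instance Definition _ := Countable.copy (tm L) (pcan_type tm_encK).

Fixpoint fml_enc (a : fml L) : GenTree.tree (rsym L * seq (tm L)) :=
  match a with
  | Bot => GenTree.Node 0 [::]
  | Rel r ts => GenTree.Leaf (r, ts)
  | And a b => GenTree.Node 1 [:: fml_enc a; fml_enc b]
  | Or a b => GenTree.Node 2 [:: fml_enc a; fml_enc b]
  | Imp a b => GenTree.Node 3 [:: fml_enc a; fml_enc b]
  | All a => GenTree.Node 4 [:: fml_enc a]
  | Exi a => GenTree.Node 5 [:: fml_enc a]
  end.

Fixpoint fml_dec (u : GenTree.tree (rsym L * seq (tm L))) : option (fml L) :=
  match u with
  | GenTree.Node 0 [::] => Some Bot
  | GenTree.Leaf (r, ts) => Some (Rel r ts)
  | GenTree.Node 1 [:: u; v] =>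
      if (fml_dec u, fml_dec v) is (Some a, Some b) then Some (And a b) else None
  | GenTree.Node 2 [:: u; v] =>
      if (fml_dec u, fml_dec v) is (Some a, Some b) then Some (Or a b) else None
  | GenTree.Node 3 [:: u; v] =>
      if (fml_dec u, fml_dec v) is (Some a, Some b) then Some (Imp a b) else None
  | GenTree.Node 4 [:: u] => omap (@All L) (fml_dec u)
  | GenTree.Node 5 [:: u] => omap (@Exi L) (fml_dec u)
  | _ => None
  end.

Lemma fml_encK : pcancel fml_enc fml_dec.
Proof. by elim=> //= [a -> b ->|a -> b ->|a -> b ->|a ->|a ->]. Qed.

HB.instance Definition _ := Countable.copy (fml L) (pcan_type fml_encK).

End Coding.

Fixpoint tm_lift L (k : nat) (t : tm L) : tm L :=
  match t with
  | Var x => Var x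
  | Bnd n => Bnd (n + k)
  | App f ts => App f (map (tm_lift k) ts)
  end.

(* [u] may contain indices that are bound around the place where it is put
   (see [openH]), hence the lifting. *)
Fixpoint tm_open L (u : tm L) (k : nat) (t : tm L) : tm L :=
  match t with
  | Var x => Var x
  | Bnd n => if n == k then tm_lift k u else Bnd n
  | App f ts => App f (map (tm_open u k) ts)
  end.

Fixpoint tm_close L (x : nat) (k : nat) (t : tm L) : tm L :=
  match t with
  | Var y => if y == x then Bnd k else Var y
  | Bnd n => Bnd n
  | App f ts => App f (map (tm_close x k) ts)
  end.

Fixpoint tm_subst L (s : nat -> tm L) (t : tm L) : tm L :=
  match t with
  | Var x => s x
  | Bnd n => Bnd n
  | App f ts => App f (map (tm_subst s) ts)
  end.

Fixpoint tm_fv L (t : tm L) : seq nat :=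
  match t with
  | Var x => [:: x]
  | Bnd _ => [::]
  | App f ts => flatten (map (@tm_fv L) ts)
  end.

(* Apply [g] to the individual terms of a formula, telling it the number of
   individual binders above. *)
Fixpoint fml_map L (g : nat -> tm L -> tm L) (k : nat) (a : fml L) : fml L :=
  match a with
  | Bot => Bot
  | Rel r ts => Rel r (map (g k) ts)
  | And a b => And (fml_map g k a) (fml_map g k b)
  | Or a b => Or (fml_map g k a) (fml_map g k b)
  | Imp a b => Imp (fml_map g k a) (fml_map g k b)
  | All a => All (fml_map g k.+1 a)
  | Exi a => Exi (fml_map g k.+1 a)
  end.

Fixpoint fml_fv L (a : fml L) : seq nat :=
  match a with
  | Bot => [::]
  | Rel r ts => flatten (map (@tm_fv L) ts)
  | And a b | Or a b | Imp a b => fml_fv a ++ fml_fv b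
  | All a | Exi a => fml_fv a
  end.

Definition fml_open L (u : tm L) (a : fml L) := fml_map (tm_open u) 0 a.
Definition fml_close L (x : nat) (a : fml L) := fml_map (tm_close x) 0 a.
(* a(t/x) *)
Definition fml_inst L (x : nat) (t : tm L) (a : fml L) :=
  fml_open t (fml_close x a).

Definition allx L x (a : fml L) := All (fml_close x a).
Definition exix L x (a : fml L) := Exi (fml_close x a).

Fixpoint TERM L (t : tm L) : bool :=
  match t with
  | Var _ => true
  | Bnd _ => false
  | App f ts => (size ts == far f) && all (@TERM L) ts
  end.

Inductive ATOM L : fml L -> Prop :=
| ATOM_bot : ATOM Bot
| ATOM_rel r ts : size ts = rar r -> all (@TERM L) ts -> ATOM (Rel r ts).

Inductive FORM L : fml L -> Prop :=
| FORM_atom a : ATOM a -> FORM a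
| FORM_and a b : FORM a -> FORM b -> FORM (And a b)
| FORM_or a b : FORM a -> FORM b -> FORM (Or a b)
| FORM_imp a b : FORM a -> FORM b -> FORM (Imp a b)
| FORM_all x a : FORM a -> FORM (allx x a)
| FORM_exi x a : FORM a -> FORM (exix x a).

Inductive recfun :=
| RZero
| RSucc
| RProj (i : nat)
| RComp (f : recfun) (gs : seq recfun)
| RPrim (f g : recfun)
| RMin (f : recfun).

Inductive recev : recfun -> seq nat -> nat -> Prop :=
| ev_zero xs : recev RZero xs 0
| ev_succ x xs : recev RSucc (x :: xs) x.+1
| ev_proj i xs : i < size xs -> recev (RProj i) xs (nth 0 xs i)
| ev_comp f gs xs ys z :
    List.Forall2 (fun g y => recev g xs y) gs ys -> recev f ys z ->
    recev (RComp f gs) xs z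
| ev_prim0 f g xs z : recev f xs z -> recev (RPrim f g) (0 :: xs) z
| ev_primS f g n xs y z :
    recev (RPrim f g) (n :: xs) y -> recev g (n :: y :: xs) z ->
    recev (RPrim f g) (n.+1 :: xs) z
| ev_min f xs n :
    recev f (n :: xs) 0 ->
    (forall m, m < n -> exists y, recev f (m :: xs) y.+1) ->
    recev (RMin f) xs n.

Definition recursive (T : countType) (P : T -> Prop) : Prop :=
  exists f, forall x,
    (P x -> recev f [:: pickle x] 1) /\ (~ P x -> recev f [:: pickle x] 0).

Record sublanguage (L : language) := Sublanguage {
  sub_f : pred (fsym L);
  sub_r : pred (rsym L) }.

Fixpoint tm_over L (M : sublanguage L) (t : tm L) : bool :=
  match t with
  | Var _ | Bnd _ => true
  | App f ts => sub_f M f && all (tm_over M) ts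
  end.

Definition ATOM_over L (M : sublanguage L) (a : fml L) : Prop :=
  ATOM a /\ match a with
            | Rel r ts => sub_r M r && all (tm_over M) ts
            | _ => true
            end.

Definition rule L : Type := seq (fml L) * fml L.

Definition production_rule L (M : sublanguage L) (r : rule L) : Prop :=
  [/\ forall a, a \in r.1 -> ATOM_over M a /\ a <> Bot,
      ATOM_over M r.2
    & forall x, x \in fml_fv r.2 -> exists2 a, a \in r.1 & x \in fml_fv a].

(* Derivations are trees of formulas; [Hyp] is an undischarged assumption. *)
Inductive der (L : language) : Type :=
| Hyp (a : fml L)
| Inf (a : fml L) (ds : seq (der L)).

Definition dconcl L (d : der L) := match d with Hyp a | Inf a _ => a end.

Fixpoint dhyps L (d : der L) : seq (fml L) :=
  match d with
  | Hyp a => [:: a]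
  | Inf _ ds => flatten (map (@dhyps L) ds)
  end.

Fixpoint dfv L (d : der L) : seq nat :=
  match d with
  | Hyp a => fml_fv a
  | Inf a ds => fml_fv a ++ flatten (map (@dfv L) ds)
  end.

Definition fml_subst L (s : nat -> tm L) (a : fml L) :=
  fml_map (fun _ => tm_subst s) 0 a.

(* The variables of a production rule are schematic: an inference is an
   instance of a rule by terms of the sublanguage. *)
Inductive derivation L (M : sublanguage L) (R : rule L -> Prop) : der L -> Prop :=
| derivation_hyp a : ATOM_over M a -> derivation M R (Hyp a)
| derivation_inf r (s : nat -> tm L) ds :
    R r -> (forall x, TERM (s x) && tm_over M (s x)) ->
    map (@dconcl L) ds = map (fml_subst s) r.1 ->
    (forall d, List.In d ds -> derivation M R d) ->
    derivation M R (Inf (fml_subst s r.2) ds).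

Definition derives L (M : sublanguage L) (R : rule L -> Prop)
    (G : seq (fml L)) (a : fml L) : Prop :=
  exists d, [/\ derivation M R d, {subset dhyps d <= G} & dconcl d = a].

(* Some recursive set of production rules has the same consequences. *)
Definition recursively_axiomatisable L (M : sublanguage L)
    (R : rule L -> Prop) : Prop :=
  exists R0 : rule L -> Prop,
    [/\ recursive R0, forall r, R0 r -> production_rule M r
      & forall G a, derives M R0 G a <-> derives M R G a].

Record atomic_system (L : language) := AtomicSystem {
  as_lang : sublanguage L;
  as_rules : rule L -> Prop;
  as_production : forall r, as_rules r -> production_rule as_lang r;
  as_recax : recursively_axiomatisable as_lang as_rules }.

(* The other two components of a base, the individual and the relational
   constants of [L], are determined by [L]. *)
Record atomic_base (L : language) := AtomicBase { base_sys : atomic_system L }.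

Definition DER L (B : atomic_base L) : der L -> Prop :=
  derivation (as_lang (base_sys B)) (as_rules (base_sys B)).

(** Individual, typed- and functional variables have separate indices.  A
    functional variable [h^a_x] is annotated with the body [fml_close x a], in
    which index 0 stands for [x]; so [h^a_x] and [h^{a(y/x)}_y] coincide for
    [y] not in [a]. *)

Inductive tvar L := TF (a : fml L) (i : nat) | TB (k : nat).
Inductive hvar L := HF (b : fml L) (i : nat) | HB (k : nat).
Inductive fvar L := FF (a : fml L) (i : nat) | FB (k : nat).
Arguments TB {L}.
Arguments HB {L}.
Arguments FB {L}.

(* An index 1, 2 of the informal notation is a boolean, [true] standing for 1.
   In [gOrI] it is part of the symbol, since the operational type alone does
   not determine it when the disjuncts coincide. *)
Definition sel T (i : bool) (x1 x2 : T) := if i then x1 else x2.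

Inductive gtm (L : language) : Type :=
| gCst (d : der L)
| gT (v : tvar L)
| gH (v : hvar L) (t : tm L)
| gF (v : fvar L) (T : gtm L)
| gAndI (T U : gtm L)
| gAndE (i : bool) (T : gtm L)
| gOrI (i : bool) (a1 a2 : fml L) (T : gtm L)
| gOrE (a b : fml L) (T U Z : gtm L)      (* binds a typed-variable in U, in Z *)
| gImpI (a : fml L) (T : gtm L)           (* binds a typed-variable *)
| gImpE (T U : gtm L)
| gAllI (T : gtm L)                       (* binds an individual variable *)
| gAllE (b c : fml L) (T : gtm L)         (* [All b |> c] *)
| gExiI (c b : fml L) (T : gtm L)         (* [c |> Exi b] *)
| gExiE (b : fml L) (T U : gtm L)         (* binds an individual variable in b
                                             and U, and a typed-variable in U *)
| gBotE (a : fml L) (T : gtm L).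

(* Free variables of all sorts; [VH] carries an abstracted body, as [HF]. *)
Inductive gvar (L : language) : Type :=
| VI (x : nat)
| VT (a : fml L) (i : nat)
| VH (b : fml L) (i : nat)
| VF (a : fml L) (i : nat).
Arguments VI {L}.

Definition gvar_enc L (v : gvar L) : nat + fml L * nat + fml L * nat + fml L * nat :=
  match v with
  | VI x => inl (inl (inl x))
  | VT a i => inl (inl (inr (a, i)))
  | VH a i => inl (inr (a, i))
  | VF a i => inr (a, i)
  end.

Definition gvar_dec L (v : nat + fml L * nat + fml L * nat + fml L * nat) : gvar L :=
  match v with
  | inl (inl (inl x)) => VI x
  | inl (inl (inr (a, i))) => VT a i
  | inl (inr (a, i)) => VH a i
  | inr (a, i) => VF a i
  end.

Lemma gvar_encK L : cancel (@gvar_enc L) (@gvar_dec L).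
Proof. by case. Qed.

HB.instance Definition _ L := Equality.copy (gvar L) (can_type (@gvar_encK L)).

(* Action on individual terms, in types and operational types as well. *)
Section MapI.
Context (L : language) (g : nat -> tm L -> tm L).

Definition tvar_mapI k (v : tvar L) :=
  match v with TF a i => TF (fml_map g k a) i | TB n => TB n end.
Definition hvar_mapI k (v : hvar L) :=
  match v with HF b i => HF (fml_map g k.+1 b) i | HB n => HB n end.
Definition fvar_mapI k (v : fvar L) :=
  match v with FF a i => FF (fml_map g k a) i | FB n => FB n end.

Fixpoint gtm_mapI k (T : gtm L) : gtm L :=
  match T with
  | gCst d => gCst d
  | gT v => gT (tvar_mapI k v)
  | gH v t => gH (hvar_mapI k v) (g k t)
  | gF v T => gF (fvar_mapI k v) (gtm_mapI k T)
  | gAndI T U => gAndI (gtm_mapI k T) (gtm_mapI k U)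
  | gAndE i T => gAndE i (gtm_mapI k T)
  | gOrI i a1 a2 T => gOrI i (fml_map g k a1) (fml_map g k a2) (gtm_mapI k T)
  | gOrE a b T U Z =>
      gOrE (fml_map g k a) (fml_map g k b)
           (gtm_mapI k T) (gtm_mapI k U) (gtm_mapI k Z)
  | gImpI a T => gImpI (fml_map g k a) (gtm_mapI k T)
  | gImpE T U => gImpE (gtm_mapI k T) (gtm_mapI k U)
  | gAllI T => gAllI (gtm_mapI k.+1 T)
  | gAllE b c T => gAllE (fml_map g k.+1 b) (fml_map g k c) (gtm_mapI k T)
  | gExiI c b T => gExiI (fml_map g k c) (fml_map g k.+1 b) (gtm_mapI k T)
  | gExiE b T U => gExiE (fml_map g k.+1 b) (gtm_mapI k T) (gtm_mapI k.+1 U)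
  | gBotE a T => gBotE (fml_map g k a) (gtm_mapI k T)
  end.

End MapI.

(* Action on the occurrences of typed- and functional variables; each component
   is told the number of binders of its own sort above. *)
Record action L := Action {
  actT : nat -> tvar L -> gtm L;
  actH : nat -> hvar L -> tm L -> gtm L;
  actF : nat -> fvar L -> gtm L -> gtm L }.

Fixpoint gtm_mapV L (m : action L) kt kh kf (T : gtm L) : gtm L :=
  match T with
  | gCst d => gCst d
  | gT v => actT m kt v
  | gH v t => actH m kh v t
  | gF v T => actF m kf v (gtm_mapV m kt kh kf T)
  | gAndI T U => gAndI (gtm_mapV m kt kh kf T) (gtm_mapV m kt kh kf U)
  | gAndE i T => gAndE i (gtm_mapV m kt kh kf T)
  | gOrI i a1 a2 T => gOrI i a1 a2 (gtm_mapV m kt kh kf T)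
  | gOrE a b T U Z =>
      gOrE a b (gtm_mapV m kt kh kf T)
           (gtm_mapV m kt.+1 kh kf U) (gtm_mapV m kt.+1 kh kf Z)
  | gImpI a T => gImpI a (gtm_mapV m kt.+1 kh kf T)
  | gImpE T U => gImpE (gtm_mapV m kt kh kf T) (gtm_mapV m kt kh kf U)
  | gAllI T => gAllI (gtm_mapV m kt kh kf T)
  | gAllE b c T => gAllE b c (gtm_mapV m kt kh kf T)
  | gExiI c b T => gExiI c b (gtm_mapV m kt kh kf T)
  | gExiE b T U => gExiE b (gtm_mapV m kt kh kf T) (gtm_mapV m kt.+1 kh kf U)
  | gBotE a T => gBotE a (gtm_mapV m kt kh kf T)
  end.

Definition tvar_is L (a : fml L) i (v : tvar L) :=
  if v is TF b j then (b == a) && (j == i) else false.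
Definition hvar_is L (a : fml L) i (v : hvar L) :=
  if v is HF b j then (b == a) && (j == i) else false.
Definition fvar_is L (a : fml L) i (v : fvar L) :=
  if v is FF b j then (b == a) && (j == i) else false.

Definition closeT L (a : fml L) i : action L :=
  {| actT k v := gT (if tvar_is a i v then TB k else v);
     actH k v t := gH v t;
     actF k v T := gF v T |}.
Definition closeH L (b : fml L) i : action L :=
  {| actT k v := gT v;
     actH k v t := gH (if hvar_is b i v then HB k else v) t;
     actF k v T := gF v T |}.
Definition closeF L (a : fml L) i : action L :=
  {| actT k v := gT v;
     actH k v t := gH v t;
     actF k v T := gF (if fvar_is a i v then FB k else v) T |}.

Definition openT L (W : gtm L) : action L :=
  {| actT k v := if v is TB n then (if n == k then W else gT v) else gT v;
     actH k v t := gH v t;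
     actF k v T := gF v T |}.
(* h(t)[U/h] = U[t/x] *)
Definition openH L (x : nat) (U : gtm L) : action L :=
  {| actT k v := gT v;
     actH k v t :=
       if v is HB n
       then (if n == k
             then gtm_mapI (tm_open t) 0 (gtm_mapI (tm_close x) 0 U)
             else gH v t)
       else gH v t;
     actF k v T := gF v T |}.
(* f(Z)[U/f] = U *)
Definition openF L (U : gtm L) : action L :=
  {| actT k v := gT v;
     actH k v t := gH v t;
     actF k v Z := if v is FB n then (if n == k then U else gF v Z) else gF v Z |}.

Fixpoint gtm_fv L (T : gtm L) : seq (gvar L) :=
  match T with
  | gCst _ => [::]
  | gT (TF a i) => VT a i :: map VI (fml_fv a)
  | gT (TB _) => [::]
  | gH (HF b i) t => VH b i :: map VI (fml_fv b ++ tm_fv t)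
  | gH (HB _) t => map VI (tm_fv t)
  | gF (FF a i) T => VF a i :: map VI (fml_fv a) ++ gtm_fv T
  | gF (FB _) T => gtm_fv T
  | gAndI T U | gImpE T U => gtm_fv T ++ gtm_fv U
  | gAndE _ T | gAllI T => gtm_fv T
  | gOrI _ a b T | gAllE a b T | gExiI a b T =>
      map VI (fml_fv a ++ fml_fv b) ++ gtm_fv T
  | gOrE a b T U Z =>
      map VI (fml_fv a ++ fml_fv b) ++ gtm_fv T ++ gtm_fv U ++ gtm_fv Z
  | gImpI a T | gBotE a T => map VI (fml_fv a) ++ gtm_fv T
  | gExiE b T U => map VI (fml_fv b) ++ gtm_fv T ++ gtm_fv U
  end.

(* No functional variable: a term of the basic Gentzen-language. *)
Fixpoint basic L (T : gtm L) : bool :=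
  match T with
  | gCst _ | gT _ => true
  | gH _ _ | gF _ _ => false
  | gAndI T U | gImpE T U | gExiE _ T U => basic T && basic U
  | gAndE _ T | gOrI _ _ _ T | gImpI _ T | gAllI T | gAllE _ _ T
  | gExiI _ _ T | gBotE _ T => basic T
  | gOrE _ _ T U Z => [&& basic T, basic U & basic Z]
  end.

(* T[t/x], T[W/xi], and the simultaneous T[t/x, W/xi^a_i]. *)
Definition gtm_instI L x (t : tm L) (T : gtm L) :=
  gtm_mapI (tm_open t) 0 (gtm_mapI (tm_close x) 0 T).
Definition gtm_instT L (a : fml L) i (W T : gtm L) :=
  gtm_mapV (openT W) 0 0 0 (gtm_mapV (closeT a i) 0 0 0 T).
Definition gtm_instIT L x (t : tm L) (a : fml L) i (W T : gtm L) :=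
  gtm_mapV (openT W) 0 0 0
    (gtm_mapI (tm_open t) 0
      (gtm_mapI (tm_close x) 0 (gtm_mapV (closeT a i) 0 0 0 T))).

Definition xi L (a : fml L) i : gtm L := gT (TF a i).
Definition hx L x (a : fml L) i (t : tm L) : gtm L := gH (HF (fml_close x a) i) t.
Definition fx L (a : fml L) i (Z : gtm L) : gtm L := gF (FF a i) Z.

Definition OrE L (a : fml L) i (b : fml L) j (T U Z : gtm L) : gtm L :=
  gOrE a b T (gtm_mapV (closeT a i) 0 0 0 U) (gtm_mapV (closeT b j) 0 0 0 Z).
Definition ImpI L (a : fml L) i (T : gtm L) : gtm L :=
  gImpI a (gtm_mapV (closeT a i) 0 0 0 T).
Definition AllI L x (T : gtm L) : gtm L := gAllI (gtm_mapI (tm_close x) 0 T).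
Definition AllE L x (a : fml L) (t : tm L) (T : gtm L) : gtm L :=
  gAllE (fml_close x a) (fml_inst x t a) T.
Definition ExiI L x (a : fml L) (t : tm L) (T : gtm L) : gtm L :=
  gExiI (fml_inst x t a) (fml_close x a) T.
Definition ExiE L x (a : fml L) i (T U : gtm L) : gtm L :=
  gExiE (fml_close x a) T
    (gtm_mapI (tm_close x) 0 (gtm_mapV (closeT a i) 0 0 0 U)).

Inductive typ L (B : atomic_base L) : gtm L -> fml L -> Prop :=
| typ_cst d :
    DER B d -> dhyps d = [::] -> dfv d = [::] -> typ B (gCst d) (dconcl d)
| typ_xi a i : FORM a -> typ B (xi a i) a
| typ_hx x a i t : FORM a -> TERM t -> typ B (hx x a i t) (fml_inst x t a)
| typ_fx a i Z c : FORM a -> typ B Z c -> basic Z -> typ B (fx a i Z) a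
| typ_andI T U a b : typ B T a -> typ B U b -> typ B (gAndI T U) (And a b)
| typ_andE i T a1 a2 : typ B T (And a1 a2) -> typ B (gAndE i T) (sel i a1 a2)
| typ_orI i T a1 a2 :
    FORM a1 -> FORM a2 -> typ B T (sel i a1 a2) ->
    typ B (gOrI i a1 a2 T) (Or a1 a2)
| typ_orE a i b j T U Z c :
    typ B T (Or a b) -> typ B U c -> typ B Z c -> typ B (OrE a i b j T U Z) c
| typ_impI a i T b : FORM a -> typ B T b -> typ B (ImpI a i T) (Imp a b)
| typ_impE T U a b : typ B T (Imp a b) -> typ B U a -> typ B (gImpE T U) b
| typ_allI x T a :
    typ B T a ->
    (forall c j, VT c j \in gtm_fv T -> x \notin fml_fv c) ->
    typ B (AllI x T) (allx x a)
| typ_allE x a t T :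
    FORM a -> TERM t -> typ B T (allx x a) -> typ B (AllE x a t T) (fml_inst x t a)
| typ_exiI x a t T :
    FORM a -> TERM t -> typ B T (fml_inst x t a) -> typ B (ExiI x a t T) (exix x a)
| typ_exiE y a i T U b :
    FORM a -> typ B T (exix y a) -> typ B U b -> y \notin fml_fv b ->
    (forall c j, VT c j \in gtm_fv U -> c <> a -> y \notin fml_fv c) ->
    typ B (ExiE y a i T U) b
| typ_botE a T : FORM a -> typ B T Bot -> typ B (gBotE a T) a.

(* Sort of a quantified variable, with the annotation of that variable. *)
Inductive vsort L := SI | ST (a : fml L) | SH (b : fml L) | SF (a : fml L).
Arguments SI {L}.

Inductive gfm (L : language) : Type :=
| Gr (T : gtm L) (a : fml L)
| Eqv (T U : gtm L)
| GBot
| GAnd (A B : gfm L)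
| GOr (A B : gfm L)
| GImp (A B : gfm L)
| GPi (s : vsort L) (A : gfm L)
| GEx (s : vsort L) (A : gfm L).
Arguments GBot {L}.

Definition GIff L (A B : gfm L) := GAnd (GImp A B) (GImp B A).

Definition sort_mapI L (g : nat -> tm L -> tm L) k (s : vsort L) :=
  match s with
  | SI => SI
  | ST a => ST (fml_map g k a)
  | SH b => SH (fml_map g k.+1 b)
  | SF a => SF (fml_map g k a)
  end.

Definition sort_fv L (s : vsort L) : seq nat :=
  match s with SI => [::] | ST a | SH a | SF a => fml_fv a end.

Definition isSI L (s : vsort L) : bool := if s is SI then true else false.
Definition isST L (s : vsort L) : bool := if s is ST _ then true else false.
Definition isSH L (s : vsort L) : bool := if s is SH _ then true else false.
Definition isSF L (s : vsort L) : bool := if s is SF _ then true else false.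

Fixpoint gfm_mapI L (g : nat -> tm L -> tm L) k (A : gfm L) : gfm L :=
  match A with
  | Gr T a => Gr (gtm_mapI g k T) (fml_map g k a)
  | Eqv T U => Eqv (gtm_mapI g k T) (gtm_mapI g k U)
  | GBot => GBot
  | GAnd A B => GAnd (gfm_mapI g k A) (gfm_mapI g k B)
  | GOr A B => GOr (gfm_mapI g k A) (gfm_mapI g k B)
  | GImp A B => GImp (gfm_mapI g k A) (gfm_mapI g k B)
  | GPi s A => GPi (sort_mapI g k s) (gfm_mapI g (isSI s + k) A)
  | GEx s A => GEx (sort_mapI g k s) (gfm_mapI g (isSI s + k) A)
  end.

Fixpoint gfm_mapV L (m : action L) kt kh kf (A : gfm L) : gfm L :=
  match A with
  | Gr T a => Gr (gtm_mapV m kt kh kf T) a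
  | Eqv T U => Eqv (gtm_mapV m kt kh kf T) (gtm_mapV m kt kh kf U)
  | GBot => GBot
  | GAnd A B => GAnd (gfm_mapV m kt kh kf A) (gfm_mapV m kt kh kf B)
  | GOr A B => GOr (gfm_mapV m kt kh kf A) (gfm_mapV m kt kh kf B)
  | GImp A B => GImp (gfm_mapV m kt kh kf A) (gfm_mapV m kt kh kf B)
  | GPi s A => GPi s (gfm_mapV m (isST s + kt) (isSH s + kh) (isSF s + kf) A)
  | GEx s A => GEx s (gfm_mapV m (isST s + kt) (isSH s + kh) (isSF s + kf) A)
  end.

Fixpoint gfm_fv L (A : gfm L) : seq (gvar L) :=
  match A with
  | Gr T a => gtm_fv T ++ map VI (fml_fv a)
  | Eqv T U => gtm_fv T ++ gtm_fv U
  | GBot => [::]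
  | GAnd A B | GOr A B | GImp A B => gfm_fv A ++ gfm_fv B
  | GPi s A | GEx s A => map VI (sort_fv s) ++ gfm_fv A
  end.

Definition gfm_close L (v : gvar L) (A : gfm L) : gfm L :=
  match v with
  | VI x => gfm_mapI (tm_close x) 0 A
  | VT a i => gfm_mapV (closeT a i) 0 0 0 A
  | VH b i => gfm_mapV (closeH b i) 0 0 0 A
  | VF a i => gfm_mapV (closeF a i) 0 0 0 A
  end.

Definition sort_of L (v : gvar L) : vsort L :=
  match v with VI _ => SI | VT a _ => ST a | VH b _ => SH b | VF a _ => SF a end.

Definition Pi L (v : gvar L) (A : gfm L) := GPi (sort_of v) (gfm_close v A).
Definition Ex L (v : gvar L) (A : gfm L) := GEx (sort_of v) (gfm_close v A).

Definition vxi L (a : fml L) i : gvar L := VT a i.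
Definition vhx L x (a : fml L) i : gvar L := VH (fml_close x a) i.
Definition vfx L (a : fml L) i : gvar L := VF a i.

Inductive wfvar L : gvar L -> Prop :=
| wfvar_I x : wfvar (VI x)
| wfvar_T a i : FORM a -> wfvar (vxi a i)
| wfvar_H x a i : FORM a -> wfvar (vhx x a i)
| wfvar_F a i : FORM a -> wfvar (vfx a i).

Inductive wff L (B : atomic_base L) : gfm L -> Prop :=
| wff_gr T a : typ B T a -> wff B (Gr T a)
| wff_eqv T U a : typ B T a -> typ B U a -> wff B (Eqv T U)
| wff_bot : wff B GBot
| wff_and A C : wff B A -> wff B C -> wff B (GAnd A C)
| wff_or A C : wff B A -> wff B C -> wff B (GOr A C)
| wff_imp A C : wff B A -> wff B C -> wff B (GImp A C)
| wff_pi v A : wfvar v -> wff B A -> wff B (Pi v A)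
| wff_ex v A : wfvar v -> wff B A -> wff B (Ex v A).

(* [instance B v A C]: C is A(tau/v), tau a term admissible for v or v itself.
   A term substituted for a functional variable is not captured by the binders
   above the occurrences of that variable. *)
Inductive instance L (B : atomic_base L) : gvar L -> gfm L -> gfm L -> Prop :=
| inst_self v A : instance B v A A
| inst_I x t A :
    TERM t ->
    instance B (VI x) A (gfm_mapI (tm_open t) 0 (gfm_close (VI x) A))
| inst_T a i T A :
    typ B T a -> basic T ->
    instance B (vxi a i) A
      (gfm_mapV (openT T) 0 0 0 (gfm_close (vxi a i) A))
| inst_H x b i U A :
    typ B U b -> basic U ->
    (forall c j, VT c j \in gtm_fv U -> x \notin fml_fv c) ->
    instance B (vhx x b i) A
      (gfm_mapV (openH x U) 0 0 0 (gfm_close (vhx x b i) A))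
| inst_F a i U A :
    typ B U a -> basic U ->
    instance B (vfx a i) A
      (gfm_mapV (openF U) 0 0 0 (gfm_close (vfx a i) A)).

Definition fresh L (v : gvar L) (G : seq (gfm L)) : Prop :=
  forall A, List.In A G -> v \notin gfm_fv A.

(* [GG B G A]: A is derivable from undischarged assumptions among G.
   A discharge may be vacuous, by [gg_weak].  Where the premise of a rule with
   proper variables has assumptions of its own, it has its own context, so that
   the proper-variable condition concerns these assumptions only.  The premises
   [wff] ensure that only formulas are derived. *)
Inductive GG L (B : atomic_base L) : seq (gfm L) -> gfm L -> Prop :=
| gg_ass A : wff B A -> GG B [:: A] A
| gg_weak G D A :
    GG B G A -> List.incl G D -> (forall C, List.In C D -> wff B C) -> GG B D A

| gg_cst d : wff B (Gr (gCst d) (dconcl d)) -> GG B [::] (Gr (gCst d) (dconcl d))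
| gg_tAndI G T U a b :
    GG B G (Gr T a) -> GG B G (Gr U b) -> GG B G (Gr (gAndI T U) (And a b))
| gg_tOrI G i T a1 a2 :
    FORM a1 -> FORM a2 -> GG B G (Gr T (sel i a1 a2)) ->
    GG B G (Gr (gOrI i a1 a2 T) (Or a1 a2))
| gg_tImpI G a i T b :
    GG B (Gr (xi a i) a :: G) (Gr T b) -> fresh (vxi a i) G ->
    GG B G (Gr (ImpI a i T) (Imp a b))
(* The renaming of x to y in the conclusion is an identity of syntax. *)
| gg_tAllI G x T a :
    GG B G (Gr T a) -> fresh (VI x) G ->
    wff B (Gr (AllI x T) (allx x a)) ->
    GG B G (Gr (AllI x T) (allx x a))
| gg_tExiI G x a t T :
    FORM a -> TERM t -> GG B G (Gr T (fml_inst x t a)) ->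
    GG B G (Gr (ExiI x a t T) (exix x a))

| gg_DAnd G D T a i b j A :
    vxi a i <> vxi b j ->
    GG B G (Gr T (And a b)) ->
    GG B [:: Eqv T (gAndI (xi a i) (xi b j)), Gr (xi a i) a, Gr (xi b j) b & D] A ->
    fresh (vxi a i) (A :: D) -> fresh (vxi b j) (A :: D) ->
    GG B (G ++ D) A
| gg_DOr G D1 D2 T a i b j A :
    GG B G (Gr T (Or a b)) ->
    GG B [:: Eqv T (gOrI true a b (xi a i)), Gr (xi a i) a & D1] A ->
    GG B [:: Eqv T (gOrI false a b (xi b j)), Gr (xi b j) b & D2] A ->
    fresh (vxi a i) (A :: D1) -> fresh (vxi b j) (A :: D2) ->
    GG B (G ++ D1 ++ D2) A
| gg_DImp G D T a i b j A :
    GG B G (Gr T (Imp a b)) ->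
    GG B [:: Eqv T (ImpI a i (fx b j (xi a i))),
             Pi (vxi a i) (GImp (Gr (xi a i) a) (Gr (fx b j (xi a i)) b)) & D] A ->
    fresh (vfx b j) (A :: D) ->
    GG B (G ++ D) A
| gg_DAll G D T x a j A :
    FORM a ->
    GG B G (Gr T (allx x a)) ->
    GG B [:: Eqv T (AllI x (hx x a j (Var x))),
             Pi (VI x) (Gr (hx x a j (Var x)) a) & D] A ->
    fresh (vhx x a j) (A :: D) ->
    GG B (G ++ D) A
| gg_DExi G D T x a i A :
    FORM a ->
    GG B G (Gr T (exix x a)) ->
    GG B [:: Eqv T (ExiI x a (Var x) (xi a i)), Gr (xi a i) a & D] A ->
    fresh (VI x) (A :: D) -> fresh (vxi a i) (A :: D) ->
    GG B (G ++ D) A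
| gg_tBot G T : GG B G (Gr T Bot) -> GG B G GBot

| gg_refl T : wff B (Eqv T T) -> GG B [::] (Eqv T T)
| gg_sym G T U : GG B G (Eqv T U) -> GG B G (Eqv U T)
| gg_trans G T U Z : GG B G (Eqv T U) -> GG B G (Eqv U Z) -> GG B G (Eqv T Z)
| gg_P G T U a : GG B G (Eqv T U) -> GG B G (Gr U a) -> GG B G (Gr T a)

| gg_cAndI G T T' U U' :
    GG B G (Eqv T T') -> GG B G (Eqv U U') ->
    GG B G (Eqv (gAndI T U) (gAndI T' U'))
| gg_cAndE G i T T' :
    GG B G (Eqv T T') -> wff B (Eqv (gAndE i T) (gAndE i T')) ->
    GG B G (Eqv (gAndE i T) (gAndE i T'))
| gg_cOrI G i a1 a2 T T' :
    GG B G (Eqv T T') -> wff B (Eqv (gOrI i a1 a2 T) (gOrI i a1 a2 T')) ->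
    GG B G (Eqv (gOrI i a1 a2 T) (gOrI i a1 a2 T'))
| gg_cOrE G a i b j T T' U U' Z Z' :
    GG B G (Eqv T T') -> GG B G (Eqv U U') -> GG B G (Eqv Z Z') ->
    wff B (Eqv (OrE a i b j T U Z) (OrE a i b j T' U' Z')) ->
    GG B G (Eqv (OrE a i b j T U Z) (OrE a i b j T' U' Z'))
| gg_cImpI G a i T T' :
    FORM a -> GG B G (Eqv T T') -> GG B G (Eqv (ImpI a i T) (ImpI a i T'))
| gg_cImpE G T T' U U' :
    GG B G (Eqv T T') -> GG B G (Eqv U U') ->
    wff B (Eqv (gImpE T U) (gImpE T' U')) ->
    GG B G (Eqv (gImpE T U) (gImpE T' U'))
| gg_cAllI G x T T' :
    GG B G (Eqv T T') -> wff B (Eqv (AllI x T) (AllI x T')) ->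
    GG B G (Eqv (AllI x T) (AllI x T'))
| gg_cAllE G x a t T T' :
    GG B G (Eqv T T') -> wff B (Eqv (AllE x a t T) (AllE x a t T')) ->
    GG B G (Eqv (AllE x a t T) (AllE x a t T'))
| gg_cExiI G x a t T T' :
    GG B G (Eqv T T') -> wff B (Eqv (ExiI x a t T) (ExiI x a t T')) ->
    GG B G (Eqv (ExiI x a t T) (ExiI x a t T'))
| gg_cExiE G y a i T T' U U' :
    GG B G (Eqv T T') -> GG B G (Eqv U U') ->
    wff B (Eqv (ExiE y a i T U) (ExiE y a i T' U')) ->
    GG B G (Eqv (ExiE y a i T U) (ExiE y a i T' U'))

| gg_jAndI G i T1 T2 U1 U2 :
    GG B G (Eqv (gAndI T1 T2) (gAndI U1 U2)) ->
    GG B G (Eqv (sel i T1 T2) (sel i U1 U2))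
| gg_jOrI G i a1 a2 T U :
    GG B G (Eqv (gOrI i a1 a2 T) (gOrI i a1 a2 U)) -> GG B G (Eqv T U)
| gg_jImpI G a i T U :
    GG B G (Eqv (ImpI a i T) (ImpI a i U)) -> wff B (Eqv T U) -> GG B G (Eqv T U)
| gg_jAllI G x T U :
    GG B G (Eqv (AllI x T) (AllI x U)) -> wff B (Eqv T U) -> GG B G (Eqv T U)
| gg_jExiI G x a t T U :
    GG B G (Eqv (ExiI x a t T) (ExiI x a t U)) -> GG B G (Eqv T U)

| gg_eAnd i T1 T2 :
    wff B (Eqv (gAndE i (gAndI T1 T2)) (sel i T1 T2)) ->
    GG B [::] (Eqv (gAndE i (gAndI T1 T2)) (sel i T1 T2))
| gg_eOr i a1 n1 a2 n2 T U1 U2 c :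
    basic T -> typ B T (sel i a1 a2) -> typ B U1 c -> typ B U2 c ->
    FORM a1 -> FORM a2 ->
    GG B [::] (Eqv (OrE a1 n1 a2 n2 (gOrI i a1 a2 T) U1 U2)
                   (gtm_instT (sel i a1 a2) (sel i n1 n2) T (sel i U1 U2)))
| gg_eImp a i T U b :
    basic U -> typ B T b -> typ B U a ->
    GG B [::] (Eqv (gImpE (ImpI a i T) U) (gtm_instT a i U T))
| gg_eAll x a t T :
    TERM t -> typ B T a -> typ B (AllI x T) (allx x a) ->
    GG B [::] (Eqv (AllE x a t (AllI x T)) (gtm_instI x t T))
| gg_eExi x a i t T U b :
    basic T -> TERM t -> typ B U b ->
    typ B (ExiE x a i (ExiI x a t T) U) b ->
    GG B [::] (Eqv (ExiE x a i (ExiI x a t T) U) (gtm_instIT x t a i T U))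

| gg_andI G A C : GG B G A -> GG B G C -> GG B G (GAnd A C)
| gg_andE1 G A C : GG B G (GAnd A C) -> GG B G A
| gg_andE2 G A C : GG B G (GAnd A C) -> GG B G C
| gg_orI1 G A C : GG B G A -> wff B C -> GG B G (GOr A C)
| gg_orI2 G A C : GG B G C -> wff B A -> GG B G (GOr A C)
| gg_orE G A C E :
    GG B G (GOr A C) -> GG B (A :: G) E -> GG B (C :: G) E -> GG B G E
| gg_impI G A C : GG B (A :: G) C -> GG B G (GImp A C)
| gg_impE G A C : GG B G (GImp A C) -> GG B G A -> GG B G C
| gg_piI G v A : wfvar v -> GG B G A -> fresh v G -> GG B G (Pi v A)
| gg_piE G v A C :
    GG B G (Pi v A) -> wff B A -> instance B v A C -> wff B C -> GG B G C
| gg_exI G v A C :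
    wfvar v -> wff B A -> instance B v A C -> GG B G C -> GG B G (Ex v A)
| gg_exE G D v A C :
    GG B G (Ex v A) -> GG B (A :: D) C -> fresh v (C :: D) -> GG B (G ++ D) C
| gg_botE G A : GG B G GBot -> wff B A -> GG B G A.

(* Main.v *)
(* Left to right, each equivalence is the type elimination rule for the
   connective, applied to the existential formula itself: its dischargeable
   assumptions are the conjuncts, and its proper variables are bound in the
   conclusion.  Right to left, the type introduction rule gives the canonical
   term its type, and preservation of denotation transfers it to the variable.
   The proper-variable conditions hold because a formula differs from its
   immediate subformulas, and because closing on a variable removes it. *)

Require Import Defs.
From mathcomp Require Import all_boot.

Set Implicit Arguments.
Unset Strict Implicit.
Unset Printing Implicit Defensive.

(** * Size, closing, opening and local closedness of formulas *)

Section Formulas.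
Context (L : language).
Implicit Types (a b : fml L) (t : tm L).

(** Tells a formula apart from the compounds built on it. A measure is used rather than the
    subformula relation because the body of [exix x a] is [fml_close x a] and not [a]. *)
Fixpoint fml_size a : nat :=
  match a with
  | Bot | Rel _ _ => 0
  | And a b | Or a b | Imp a b => (fml_size a + fml_size b).+1
  | All a | Exi a => (fml_size a).+1
  end.

Lemma fml_size_map g k a : fml_size (fml_map g k a) = fml_size a.
Proof.
by elim: a k => //= [a IHa b IHb|a IHa b IHb|a IHa b IHb|a IHa|a IHa] k;
  rewrite ?IHa ?IHb.
Qed.

(** Both orientations are needed for rewriting: closing compares the type of an occurrence with that
    of the variable, while membership compares them in the opposite order. *)
Lemma fml_size_neq a b :
  fml_size a < fml_size b -> ((a == b) = false) * ((b == a) = false).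
Proof.
move=> lt_ab; rewrite [b == a]eq_sym; suff -> : (a == b) = false by [].
by apply/eqP => eq_ab; rewrite eq_ab ltnn in lt_ab.
Qed.

Lemma tm_close_fv x k t : x \notin tm_fv (tm_close x k t).
Proof.
elim/tm_ind_nested: t => //= [y|f ts].
  by case: eqP => //= /eqP; rewrite inE eq_sym.
by elim=> //= t {}ts xt _ xts; rewrite mem_cat negb_or xt.
Qed.

Lemma fml_close_fv x k a : (x \in fml_fv (fml_map (tm_close x) k a)) = false.
Proof.
elim: a k => //= [r ts|a IHa b IHb|a IHa b IHb|a IHa b IHb] k;
  rewrite ?mem_cat ?IHa ?IHb //.
elim: ts => //= t ts IHts; rewrite mem_cat IHts orbF.
by apply: negbTE; apply: tm_close_fv.
Qed.

Lemma tm_close_id x k t : x \notin tm_fv t -> tm_close x k t = t.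
Proof.
elim/tm_ind_nested: t => //= [y|f ts IHts xts].
  by rewrite inE eq_sym => /negPf->.
congr (App f _); elim: IHts xts => //= t {}ts IHt _ IHts.
by rewrite mem_cat negb_or => /andP[/IHt-> /IHts->].
Qed.

(** Makes a further closing harmless on annotations such as [fml_close x a], in which [x] is already
    abstracted. *)
Lemma fml_close_id x k a : x \notin fml_fv a -> fml_map (tm_close x) k a = a.
Proof.
elim: a k => //= [r ts|a IHa b IHb|a IHa b IHb|a IHa b IHb|a IHa|a IHa] k;
  try by rewrite mem_cat negb_or => /andP[xa xb]; rewrite IHa ?IHb.
- move=> xts; congr (Rel r _); elim: ts xts => //= t ts IHts.
  by rewrite mem_cat negb_or => /andP[xt /IHts->]; rewrite tm_close_id.
- by move=> xa; rewrite IHa.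
- by move=> xa; rewrite IHa.
Qed.

(** [FORM] is generated by named binders and says nothing of raw bodies, so inductions on syntax
    rely on this bound for the indices. *)
Fixpoint tm_lc k t : bool :=
  match t with
  | Var _ => true
  | Bnd n => n < k
  | App _ ts => all (tm_lc k) ts
  end.

Fixpoint fml_lc k a : bool :=
  match a with
  | Bot => true
  | Rel _ ts => all (tm_lc k) ts
  | And a b | Or a b | Imp a b => fml_lc k a && fml_lc k b
  | All a | Exi a => fml_lc k.+1 a
  end.

Lemma TERM_lc k t : TERM t -> tm_lc k t.
Proof.
elim/tm_ind_nested: t => //= f ts IHts /andP[_].
by elim: IHts => //= t {}ts IHt _ IHts /andP[/IHt-> /IHts].
Qed.

Lemma tm_close_lc x k t : tm_lc k t -> tm_lc k.+1 (tm_close x k t).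
Proof.
elim/tm_ind_nested: t => //= [y _|n|f ts].
- by case: eqP => //= _; apply: ltnSn.
- exact: ltnW.
- by elim=> //= t {}ts IHt _ IHts /andP[/IHt-> /IHts].
Qed.

Lemma fml_close_lc x k a :
  fml_lc k a -> fml_lc k.+1 (fml_map (tm_close x) k a).
Proof.
elim: a k => //= [r ts|a IHa b IHb|a IHa b IHb|a IHa b IHb|a IHa|a IHa] k;
  try by case/andP=> /IHa-> /IHb->.
- by elim: ts => //= t ts IHts /andP[/tm_close_lc-> /IHts].
- exact: IHa.
- exact: IHa.
Qed.

Lemma FORM_lc a : FORM a -> fml_lc 0 a.
Proof.
elim=> {a} [_ [//|r ts _ /=]|a b _ /= -> _ ->|a b _ /= -> _ ->
           |a b _ /= -> _ ->|x a _|x a _] //=.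
- by apply: sub_all => t; apply: TERM_lc.
- exact: fml_close_lc.
- exact: fml_close_lc.
Qed.

(** Local closedness keeps the index [k] out of [t], so opening reaches exactly the places where
    closing abstracted [x]. *)
Lemma tm_open_close x k t :
  tm_lc k t -> tm_open (Var x) k (tm_close x k t) = t.
Proof.
elim/tm_ind_nested: t => //= [y _|n lt_nk|f ts IHts lc_ts].
- by case: eqP => [->|//]; rewrite /= eqxx.
- by rewrite ltn_eqF.
congr (App f _); elim: IHts lc_ts => //= t {}ts IHt _ IHts.
by case/andP=> /IHt-> /IHts->.
Qed.

Lemma fml_open_close x k a : fml_lc k a ->
  fml_map (tm_open (Var x)) k (fml_map (tm_close x) k a) = a.
Proof.
elim: a k => //= [r ts|a IHa b IHb|a IHa b IHb|a IHa b IHb|a IHa|a IHa] k;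
  try by case/andP=> /IHa-> /IHb->.
- move=> lc_ts; congr (Rel r _); elim: ts lc_ts => //= t ts IHts.
  by case/andP=> /tm_open_close-> /IHts->.
- by move/IHa->.
- by move/IHa->.
Qed.

(** At [Var x], [typ_hx] and the rules for [ExiI] speak of the instance a(x/x), where the
    equivalences have [a] itself. *)
Lemma fml_inst_id x a : FORM a -> fml_inst x (Var x) a = a.
Proof. by move/FORM_lc/fml_open_close; apply. Qed.

End Formulas.

(** * Membership in lists of free variables of the four sorts *)

Section FreeVariables.
Context (L : language).

Lemma VT_VI (a : fml L) i s : (VT a i \in map VI s) = false.
Proof. by elim: s. Qed.

Lemma VH_VI (a : fml L) i s : (VH a i \in map VI s) = false.
Proof. by elim: s. Qed.

Lemma VF_VI (a : fml L) i s : (VF a i \in map VI s) = false.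
Proof. by elim: s. Qed.

Lemma VI_VI x s : (@VI L x \in map VI s) = (x \in s).
Proof. by apply: mem_map => y z []. Qed.

Lemma VT_eq (a b : fml L) i j : (VT a i == VT b j) = (a == b) && (i == j).
Proof. by []. Qed.

Definition fvE := (mem_cat, in_cons, VT_VI, VH_VI, VF_VI, VI_VI, VT_eq).

End FreeVariables.

(** * Derived rules of [GG] *)

Section Derived.
Context (L : language) (B : atomic_base L).
Implicit Types (A C : gfm L) (G : seq (gfm L)).

Lemma GG_mem G A : List.Forall (wff B) G -> List.In A G -> GG B G A.
Proof.
move=> /List.Forall_forall wfG AG; apply: gg_weak (gg_ass (wfG _ AG)) _ wfG.
by move=> C [<-|[]].
Qed.

Lemma fresh_seq1 v A : v \notin gfm_fv A -> fresh v [:: A].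
Proof. by move=> vA C [<-|[]]. Qed.

(** With an empty side context, the conclusion is the only place where the proper variable has to be
    absent. *)
Lemma GG_Ex_elim v A C :
  wff B (Ex v A) -> GG B [:: A] C -> v \notin gfm_fv C -> GG B [:: Ex v A] C.
Proof.
move=> wfE AC vC; rewrite -[[:: Ex v A]]cats0.
by apply: gg_exE (gg_ass wfE) AC _; apply: fresh_seq1.
Qed.

(** Each variable serves as its own witness, so no substitution has to be computed. *)
Lemma GG_Ex_intro G v A : wfvar v -> wff B A -> GG B G A -> GG B G (Ex v A).
Proof. by move=> wv wA; apply: gg_exI (inst_self B v A). Qed.

(** The minor premises of [gg_orE] keep the context of the major one, so both are first weakened by
    the disjunction. *)
Lemma GG_Or_elim A C E : wff B A -> wff B C ->
  GG B [:: A] E -> GG B [:: C] E -> GG B [:: GOr A C] E.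
Proof.
move=> wA wC AE CE; have wAC := wff_or wA wC.
have wG F D : wff B F -> List.In D [:: F; GOr A C] -> wff B D.
  by move=> wF /= [<-|[<-|[]]].
have sG F : List.incl [:: F] [:: F; GOr A C] by move=> D /= [->|[]]; left.
apply: gg_orE (gg_ass wAC) _ _.
- by apply: gg_weak AE (sG A) _ => D; apply: wG.
- by apply: gg_weak CE (sG C) _ => D; apply: wG.
Qed.

(** The context is empty, so generalising over the typed-variable meets no proper-variable
    restriction. *)
Lemma GG_Pi_Iff a n A C : FORM a ->
  GG B [:: A] C -> GG B [:: C] A -> GG B [::] (Pi (vxi a n) (GIff A C)).
Proof.
move=> Fa AC CA; apply: gg_piI => //; first exact: wfvar_T.
by apply: gg_andI; apply: gg_impI.
Qed.

(** * The five equivalences *)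

(** Distinctness of the two variables matters when [a] and [b] coincide: [gg_DAnd] requires it, and
    otherwise both components would be the same variable. *)
Lemma GG_And_char a b n i j : FORM a -> FORM b -> vxi a i <> vxi b j ->
  GG B [::]
    (Pi (vxi (And a b) n)
      (GIff (Gr (xi (And a b) n) (And a b))
            (Ex (vxi a i) (Ex (vxi b j)
              (GAnd (Eqv (xi (And a b) n) (gAndI (xi a i) (xi b j)))
                    (GAnd (Gr (xi a i) a) (Gr (xi b j) b))))))).
Proof.
move=> Fa Fb ne.
have sa : fml_size a < fml_size (And a b) by rewrite /= ltnS leq_addr.
have sb : fml_size b < fml_size (And a b) by rewrite /= ltnS leq_addl.
move/fml_size_neq in sa; move/fml_size_neq in sb.
have ne' : (a == b) && (i == j) = false.
  by apply/negP => /andP[/eqP eab /eqP eij]; apply: ne; rewrite eab eij.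
have FC : FORM (And a b) by apply: FORM_and.
have tA := typ_xi B i Fa; have tB := typ_xi B j Fb; have tC := typ_xi B n FC.
have wEq : wff B (Eqv (xi (And a b) n) (gAndI (xi a i) (xi b j))).
  by apply: wff_eqv tC _; apply: typ_andI.
have wM : wff B (GAnd (Eqv (xi (And a b) n) (gAndI (xi a i) (xi b j)))
                      (GAnd (Gr (xi a i) a) (Gr (xi b j) b))).
  by do 2!(apply: wff_and; last 1 first) => //; apply: wff_gr.
have wE2 := wff_ex (wfvar_T j Fb) wM.
have wE1 := wff_ex (wfvar_T i Fa) wE2.
apply: GG_Pi_Iff => //.
- apply: (gg_DAnd (D := [::]) ne (gg_ass (wff_gr tC))).
  + have wG : List.Forall (wff B)
        [:: Eqv (xi (And a b) n) (gAndI (xi a i) (xi b j));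
            Gr (xi a i) a; Gr (xi b j) b].
      by do !apply: List.Forall_cons => //; apply: wff_gr.
    do 2!(apply: GG_Ex_intro => //; first exact: wfvar_T).
    by do 2?apply: gg_andI; apply: GG_mem => //=; tauto.
  + apply: fresh_seq1.
    (* The inner closing catches only [xi b j] by [ne'], the outer one only [xi a i]; the size
       comparisons protect the variable of conjunction type. *)
    by rewrite /vxi /= sb ne' !eqxx /= sa !eqxx /= !fvE sa.
  + apply: fresh_seq1.
    by rewrite /vxi /= sb ne' !eqxx /= sa !eqxx /= !fvE sb.
- apply: GG_Ex_elim => //; first apply: GG_Ex_elim => //.
  + have gM := gg_ass wM; apply: gg_P (gg_andE1 gM) _.
    by apply: gg_tAndI; [apply: gg_andE1|apply: gg_andE2]; apply: gg_andE2 gM.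
  + by rewrite /vxi /= !fvE sb.
  + by rewrite /vxi /= !fvE sa.
Qed.

(** The two variables may coincide, since each disjunct, like each minor derivation of [gg_DOr],
    involves only one of them. *)
Lemma GG_Or_char a b n i j : FORM a -> FORM b ->
  GG B [::]
    (Pi (vxi (Or a b) n)
      (GIff (Gr (xi (Or a b) n) (Or a b))
            (Ex (vxi a i) (Ex (vxi b j)
              (GOr (GAnd (Eqv (xi (Or a b) n) (gOrI true a b (xi a i)))
                         (Gr (xi a i) a))
                   (GAnd (Eqv (xi (Or a b) n) (gOrI false a b (xi b j)))
                         (Gr (xi b j) b))))))).
Proof.
move=> Fa Fb.
have sa : fml_size a < fml_size (Or a b) by rewrite /= ltnS leq_addr.
have sb : fml_size b < fml_size (Or a b) by rewrite /= ltnS leq_addl.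
move/fml_size_neq in sa; move/fml_size_neq in sb.
have FC : FORM (Or a b) by apply: FORM_or.
have tA := typ_xi B i Fa; have tB := typ_xi B j Fb; have tC := typ_xi B n FC.
have wA := wff_gr tA; have wB := wff_gr tB.
have wEqA : wff B (Eqv (xi (Or a b) n) (gOrI true a b (xi a i))).
  by apply: wff_eqv tC _; apply: typ_orI.
have wEqB : wff B (Eqv (xi (Or a b) n) (gOrI false a b (xi b j))).
  by apply: wff_eqv tC _; apply: typ_orI.
have wMA := wff_and wEqA wA; have wMB := wff_and wEqB wB.
have wM := wff_or wMA wMB.
have wE2 := wff_ex (wfvar_T j Fb) wM.
have wE1 := wff_ex (wfvar_T i Fa) wE2.
apply: GG_Pi_Iff => //.
- apply: (gg_DOr (i := i) (j := j) (D1 := [::]) (D2 := [::]) (gg_ass (wff_gr tC))).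
  + have wG := List.Forall_cons _ wEqA (List.Forall_cons _ wA (List.Forall_nil _)).
    do 2!(apply: GG_Ex_intro => //; first exact: wfvar_T).
    by apply: gg_orI1 => //; apply: gg_andI; apply: GG_mem => //=; tauto.
  + have wG := List.Forall_cons _ wEqB (List.Forall_cons _ wB (List.Forall_nil _)).
    do 2!(apply: GG_Ex_intro => //; first exact: wfvar_T).
    by apply: gg_orI2 => //; apply: gg_andI; apply: GG_mem => //=; tauto.
  + apply: fresh_seq1.
    (* If the variables coincide, the inner quantifier binds all their occurrences and the outer one
       is vacuous; otherwise each binds its own. *)
    by case e: ((a == b) && (i == j));
      rewrite /vxi /= sb !eqxx e /= sa ?eqxx /= !fvE sa.
  + apply: fresh_seq1.
    by case e: ((a == b) && (i == j));
      rewrite /vxi /= sb !eqxx e /= sa ?eqxx /= !fvE sb.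
- apply: GG_Ex_elim => //; first apply: GG_Ex_elim => //.
  + apply: GG_Or_elim => //.
    * have gM := gg_ass wMA; apply: gg_P (gg_andE1 gM) _.
      by apply: gg_tOrI => //; apply: gg_andE2 gM.
    * have gM := gg_ass wMB; apply: gg_P (gg_andE1 gM) _.
      by apply: gg_tOrI => //; apply: gg_andE2 gM.
  + by rewrite /vxi /= !fvE sb.
  + by rewrite /vxi /= !fvE sa.
Qed.

Lemma GG_Imp_char a b n i j : FORM a -> FORM b ->
  GG B [::]
    (Pi (vxi (Imp a b) n)
      (GIff (Gr (xi (Imp a b) n) (Imp a b))
            (Ex (vfx b j)
              (GAnd (Eqv (xi (Imp a b) n) (ImpI a i (fx b j (xi a i))))
                    (Pi (vxi a i)
                      (GImp (Gr (xi a i) a) (Gr (fx b j (xi a i)) b))))))).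
Proof.
move=> Fa Fb.
have sa : fml_size a < fml_size (Imp a b) by rewrite /= ltnS leq_addr.
move/fml_size_neq in sa.
have FC : FORM (Imp a b) by apply: FORM_imp.
have tA := typ_xi B i Fa; have tC := typ_xi B n FC.
have tF : typ B (fx b j (xi a i)) b by apply: typ_fx tA _.
have wEq : wff B (Eqv (xi (Imp a b) n) (ImpI a i (fx b j (xi a i)))).
  by apply: wff_eqv tC _; apply: typ_impI.
have wI := wff_imp (wff_gr tA) (wff_gr tF).
have wP := wff_pi (wfvar_T i Fa) wI.
have wM := wff_and wEq wP.
have wE := wff_ex (wfvar_F j Fb) wM.
apply: GG_Pi_Iff => //.
- apply: (gg_DImp (i := i) (j := j) (D := [::]) (gg_ass (wff_gr tC))).
  + have wG := List.Forall_cons _ wEq (List.Forall_cons _ wP (List.Forall_nil _)).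
    apply: GG_Ex_intro => //; first exact: wfvar_F.
    by apply: gg_andI; apply: GG_mem => //=; tauto.
  + apply: fresh_seq1.
    by rewrite /vfx /= !eqxx /= !fvE.
- apply: GG_Ex_elim => //; last by rewrite /vfx /= !fvE.
  have gM := gg_ass wM; apply: gg_P (gg_andE1 gM) _.
  apply: gg_tImpI.
  + have wG := List.Forall_cons _ (wff_gr tA)
      (List.Forall_cons _ wM (List.Forall_nil _)).
    (* The quantified implication is taken at [xi a i] itself, whose typing is the assumption that
       [gg_tImpI] discharges. *)
    apply: gg_impE (GG_mem wG (or_introl erefl)).
    apply: (gg_piE (v := vxi a i) _ wI (inst_self _ _ _) wI).
    by apply: gg_andE2 (GG_mem wG (or_intror (or_introl erefl))).
  + apply: fresh_seq1.
    (* [ImpI] and [Pi] bind every occurrence of [xi a i], so only the variable of implication type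
       remains to be compared with it. *)
    by rewrite /vxi /= !eqxx /= !fvE sa.
Qed.

Lemma GG_All_char x a n j : FORM a ->
  GG B [::]
    (Pi (vxi (allx x a) n)
      (GIff (Gr (xi (allx x a) n) (allx x a))
            (Ex (vhx x a j)
              (GAnd (Eqv (xi (allx x a) n) (AllI x (hx x a j (Var x))))
                    (Pi (VI x) (Gr (hx x a j (Var x)) a)))))).
Proof.
move=> Fa.
have FC : FORM (allx x a) by apply: FORM_all.
have tC := typ_xi B n FC.
have tH : typ B (hx x a j (Var x)) a.
  by rewrite -[X in typ _ _ X](fml_inst_id x Fa); apply: typ_hx.
have tI : typ B (AllI x (hx x a j (Var x))) (allx x a).
  (* No typed-variable is free in the h-term, so the side condition on their types is vacuous. *)
  by apply: typ_allI tH _ => c k; rewrite /= !fvE.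
have wEq := wff_eqv tC tI.
have wP := wff_pi (wfvar_I L x) (wff_gr tH).
have wM := wff_and wEq wP.
have wE := wff_ex (wfvar_H x j Fa) wM.
(* [AllI x] and [Pi (VI x)] close the annotation of the functional variable on [x] once more; it
   must stay unchanged for the existential quantifier to recognise and bind these occurrences. *)
have xa k : fml_map (tm_close x) k (fml_close x a) = fml_close x a.
  by rewrite fml_close_id ?fml_close_fv.
apply: GG_Pi_Iff => //.
- apply: (gg_DAll (j := j) (D := [::]) Fa (gg_ass (wff_gr tC))).
  + have wG := List.Forall_cons _ wEq (List.Forall_cons _ wP (List.Forall_nil _)).
    apply: GG_Ex_intro => //; first exact: wfvar_H.
    by apply: gg_andI; apply: GG_mem => //=; tauto.
  + apply: fresh_seq1.
    by rewrite /vhx /= !eqxx /= !xa !eqxx /= !fvE.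
- apply: GG_Ex_elim => //; last by rewrite /vhx /= !fvE.
  have gM := gg_ass wM; apply: gg_P (gg_andE1 gM) _.
  apply: gg_tAllI (wff_gr tI).
  + by apply: gg_piE (gg_andE2 gM) _ (inst_self _ _ _) _; apply: wff_gr.
  + apply: fresh_seq1.
    by rewrite /= eqxx !xa /= !fvE !fml_close_fv.
Qed.

Lemma GG_Exi_char x a n i : FORM a ->
  GG B [::]
    (Pi (vxi (exix x a) n)
      (GIff (Gr (xi (exix x a) n) (exix x a))
            (Ex (VI x) (Ex (vxi a i)
              (GAnd (Eqv (xi (exix x a) n) (ExiI x a (Var x) (xi a i)))
                    (Gr (xi a i) a)))))).
Proof.
move=> Fa.
(* The quantified body is a closed form of [a], which has the same size. *)
have sa : fml_size a < fml_size (exix x a) by rewrite /= fml_size_map.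
move/fml_size_neq in sa.
have FC : FORM (exix x a) by apply: FORM_exi.
have tA := typ_xi B i Fa; have tC := typ_xi B n FC.
have tI : typ B (ExiI x a (Var x) (xi a i)) (exix x a).
  by apply: typ_exiI => //; rewrite fml_inst_id.
have wEq := wff_eqv tC tI.
have wM := wff_and wEq (wff_gr tA).
have wE2 := wff_ex (wfvar_T i Fa) wM.
have wE1 := wff_ex (wfvar_I L x) wE2.
(* Proper-variable condition for eliminating the outer quantifier: the typing formula contains only
   the abstracted body. *)
have xx : VI x \notin gfm_fv (Gr (xi (exix x a) n) (exix x a)).
  by rewrite /= !fvE !fml_close_fv.
apply: GG_Pi_Iff => //.
- apply: (gg_DExi (i := i) (D := [::]) Fa (gg_ass (wff_gr tC))).
  + have wG : List.Forall (wff B)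
        [:: Eqv (xi (exix x a) n) (ExiI x a (Var x) (xi a i)); Gr (xi a i) a].
      by do !apply: List.Forall_cons => //; apply: wff_gr.
    apply: GG_Ex_intro => //; first exact: wfvar_I.
    apply: GG_Ex_intro => //; first exact: wfvar_T.
    by apply: gg_andI; apply: GG_mem => //=; tauto.
  + apply: fresh_seq1.
    by rewrite /= sa !eqxx /= !fvE !fml_close_fv.
  + apply: fresh_seq1.
    (* The outer quantifier over [x] also acts on the types of typed-variables; the type [exix x a]
       is restored before sizes are compared. *)
    rewrite /vxi /= sa !eqxx /= !fvE fml_close_id ?fml_close_fv //.
    by rewrite -/(exix x a) sa.
- apply: GG_Ex_elim => //; first apply: GG_Ex_elim => //.
  + have gM := gg_ass wM; apply: gg_P (gg_andE1 gM) _.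
    by apply: gg_tExiI; rewrite ?fml_inst_id //; apply: gg_andE2 gM.
  + by rewrite /vxi /= !fvE sa.
Qed.

End Derived.

Theorem mainTheorem2 (L : language) (B : atomic_base L) :
  (forall (a b : fml L) (n i j : nat), FORM a -> FORM b -> vxi a i <> vxi b j ->
    GG B [::]
      (Pi (vxi (And a b) n)
        (GIff (Gr (xi (And a b) n) (And a b))
              (Ex (vxi a i) (Ex (vxi b j)
                (GAnd (Eqv (xi (And a b) n) (gAndI (xi a i) (xi b j)))
                      (GAnd (Gr (xi a i) a) (Gr (xi b j) b))))))))
  /\
  (forall (a b : fml L) (n i j : nat), FORM a -> FORM b ->
    GG B [::]
      (Pi (vxi (Or a b) n)
        (GIff (Gr (xi (Or a b) n) (Or a b))
              (Ex (vxi a i) (Ex (vxi b j)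
                (GOr (GAnd (Eqv (xi (Or a b) n) (gOrI true a b (xi a i)))
                           (Gr (xi a i) a))
                     (GAnd (Eqv (xi (Or a b) n) (gOrI false a b (xi b j)))
                           (Gr (xi b j) b))))))))
  /\
  (forall (a b : fml L) (n i j : nat), FORM a -> FORM b ->
    GG B [::]
      (Pi (vxi (Imp a b) n)
        (GIff (Gr (xi (Imp a b) n) (Imp a b))
              (Ex (vfx b j)
                (GAnd (Eqv (xi (Imp a b) n) (ImpI a i (fx b j (xi a i))))
                      (Pi (vxi a i)
                        (GImp (Gr (xi a i) a) (Gr (fx b j (xi a i)) b))))))))
  /\
  (forall (x : nat) (a : fml L) (n j : nat), FORM a ->
    GG B [::]
      (Pi (vxi (allx x a) n)
        (GIff (Gr (xi (allx x a) n) (allx x a))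
              (Ex (vhx x a j)
                (GAnd (Eqv (xi (allx x a) n) (AllI x (hx x a j (Var x))))
                      (Pi (VI x) (Gr (hx x a j (Var x)) a)))))))
  /\
  (forall (x : nat) (a : fml L) (n i : nat), FORM a ->
    GG B [::]
      (Pi (vxi (exix x a) n)
        (GIff (Gr (xi (exix x a) n) (exix x a))
              (Ex (VI x) (Ex (vxi a i)
                (GAnd (Eqv (xi (exix x a) n) (ExiI x a (Var x) (xi a i)))
                      (Gr (xi a i) a))))))).
Proof.
do 4?split; move=> *;
  [exact: GG_And_char|exact: GG_Or_char|exact: GG_Imp_char
  |exact: GG_All_char|exact: GG_Exi_char].
Qed.
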